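(* Let $A, B\in \mathbb{C}^{m\times n}$ and let $r=\operatorname{rank}(A)$. Then the following are equivalent: (i) $BA^*=0$ (that is, $A$ is right $*$-orthogonal to $B$); (ii) there exist unitary matrices $U\in \mathbb{C}^{m\times m}$ and $V\in \mathbb{C}^{n\times n}$, and a nonsingular matrix $\Sigma\in\mathbb{C}^{r\times r}$ such that $$A=U\begin{bmatrix}\Sigma & 0\\ 0& 0\end{bmatrix}V^*,\qquad B=U\begin{bmatrix}0 & B_2\\ 0& B_4\end{bmatrix}V^*,$$ where $B_2\in \mathbb{C}^{r\times (n-r)}$ and $B_4\in \mathbb{C}^{(m-r)\times (n-r)}$. In this case (for any such decomposition), $$B^\dagger = V\begin{bmatrix}0 & 0\\ (B_2^*B_2+B_4^*B_4)^\dagger B_2^* & (B_2^*B_2+B_4^*B_4)^\dagger B_4^*\end{bmatrix}U^*.$$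
   Context: $M^*$ denotes the conjugate transpose of $M$ and $M^\dagger$ its Moore-Penrose inverse, i.e. the unique matrix satisfying $MM^\dagger M=M$, $M^\dagger MM^\dagger=M^\dagger$, $(MM^\dagger)^*=MM^\dagger$, $(M^\dagger M)^*=M^\dagger M$. Blocks with zero rows or columns are allowed. *)

(* Defs.v *)
From mathcomp Require Import all_boot all_order all_algebra.
From mathcomp Require Import spectral sesquilinear.
From mathcomp Require Import complex.
From mathcomp Require Import reals.

Set Implicit Arguments.
Unset Strict Implicit.
Unset Printing Implicit Defensive.

Import Order.TTheory GRing.Theory Num.Theory.
Local Open Scope ring_scope.
Local Open Scope sesquilinear_scope.

Section MoorePenrose.
Context {C : numClosedFieldType}.

Definition is_mpinv m n (M : 'M[C]_(m, n)) (X : 'M[C]_(n, m)) : bool :=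
  [&& M *m X *m M == M,
      X *m M *m X == X,
      (M *m X)^t* == M *m X
    & (X *m M)^t* == X *m M].

Lemma mul_trmxC m n p (M : 'M[C]_(m, n)) (N : 'M[C]_(n, p)) :
  (M *m N)^t* = N^t* *m M^t*.
Proof. by rewrite trmx_mul map_mxM. Qed.

Lemma trmxC_inv n (M : 'M[C]_n) : (invmx M)^t* = invmx (M^t*).
Proof. by rewrite trmx_inv map_invmx. Qed.

Lemma gram_unitmx m n (M : 'M[C]_(m, n)) :
  row_free M -> M *m M^t* \in unitmx.
Proof.
move=> Mfree; rewrite -row_free_unit -kermx_eq0; apply/rowV0P => u.
move=> /sub_kermxP uMM0; apply/eqP; rewrite -(mulmx_free_eq0 u Mfree).
apply: contraTT isT => /(@dotmx_is_dotmx C n); rewrite dotmxE mul_trmxC.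
by rewrite !mulmxA -(mulmxA u) uMM0 mul0mx mxE ltxx.
Qed.

Lemma mpinv_full_rank m r n (F : 'M[C]_(m, r)) (G : 'M[C]_(r, n)) :
  row_full F -> row_free G ->
  is_mpinv (F *m G)
    (G^t* *m invmx (G *m G^t*) *m invmx (F^t* *m F) *m F^t*).
Proof.
move=> Ffull Gfree.
have GG : G *m G^t* \in unitmx by apply: gram_unitmx.
have FF : F^t* *m F \in unitmx.
  rewrite -{2}[F]trmxCK; apply: gram_unitmx.
  by rewrite /row_free mxrank_map mxrank_tr.
set P := invmx (G *m _); set Q := invmx (F^t* *m _).
have PG : G *m G^t* *m P = 1%:M by rewrite mulmxV.
have QF : Q *m (F^t* *m F) = 1%:M by rewrite mulVmx.
have PE : P^t* = P by rewrite /P trmxC_inv mul_trmxC trmxCK.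
have QE : Q^t* = Q by rewrite /Q trmxC_inv mul_trmxC trmxCK.
rewrite /is_mpinv.
have -> : F *m G *m (G^t* *m P *m Q *m F^t*) = F *m Q *m F^t*.
  rewrite !mulmxA -(mulmxA F G) -(mulmxA F (G *m _)).
  by rewrite PG mulmx1.
have -> : G^t* *m P *m Q *m F^t* *m (F *m G) = G^t* *m P *m G.
  rewrite !mulmxA -(mulmxA _ _ F) -(mulmxA _ Q).
  by rewrite QF mulmx1.
rewrite !mul_trmxC !trmxCK PE QE !mulmxA !eqxx !andbT; apply/andP; split.
  by rewrite -(mulmxA _ _ F) -(mulmxA F) QF mulmx1.
by rewrite -(mulmxA _ G) -(mulmxA _ (G *m _)) PG mulmx1.
Qed.

Lemma mpinv_exists m n (M : 'M[C]_(m, n)) : exists X, is_mpinv M X.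
Proof.
have := mpinv_full_rank (col_base_full M) (row_base_free M).
by rewrite mulmx_base => MP; eexists; exact: MP.
Qed.

Definition mpinv m n (M : 'M[C]_(m, n)) : 'M[C]_(n, m) :=
  xchoose (mpinv_exists M).

Lemma mpinvP m n (M : 'M[C]_(m, n)) : is_mpinv M (mpinv M).
Proof. exact: xchooseP. Qed.

Lemma is_mpinv_uniq m n (M : 'M[C]_(m, n)) X Y :
  is_mpinv M X -> is_mpinv M Y -> X = Y.
Proof.
move=> /and4P[/eqP X1 /eqP X2 /eqP X3 /eqP X4].
move=> /and4P[/eqP Y1 /eqP Y2 /eqP Y3 /eqP Y4].
have MXY : M *m X = M *m Y.
  by rewrite -X3 -{1}Y1 -[M *m Y *m M *m X]mulmxA mul_trmxC X3 Y3 !mulmxA X1.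
have XYM : X *m M = Y *m M.
  by rewrite -X4 -{1}Y1 -(mulmxA M) mulmxA mul_trmxC X4 Y4 -!mulmxA
             [M *m (X *m M)]mulmxA X1.
by rewrite -X2 XYM -mulmxA MXY mulmxA Y2.
Qed.

End MoorePenrose.

Section Decomposition.
Context {C : numClosedFieldType} {m n : nat}.

(* The blocks have sizes r + (m - r) and r + (n - r) with r = \rank A; these
   casts identify them with m and n. *)
Definition rank_block (A : 'M[C]_(m, n))
    (M : 'M[C]_(\rank A + (m - \rank A), \rank A + (n - \rank A))) :
    'M[C]_(m, n) :=
  castmx (subnKC (rank_leq_row A), subnKC (rank_leq_col A)) M.

Definition rank_block_tr (A : 'M[C]_(m, n))
    (M : 'M[C]_(\rank A + (n - \rank A), \rank A + (m - \rank A))) :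
    'M[C]_(n, m) :=
  castmx (subnKC (rank_leq_col A), subnKC (rank_leq_row A)) M.

Arguments rank_block A M : clear implicits.

Definition star_decomp (A B : 'M[C]_(m, n)) (U : 'M[C]_m) (V : 'M[C]_n)
    (Sigma : 'M[C]_(\rank A))
    (B2 : 'M[C]_(\rank A, n - \rank A))
    (B4 : 'M[C]_(m - \rank A, n - \rank A)) : Prop :=
  [/\ U \is unitarymx, V \is unitarymx, Sigma \in unitmx,
      A = U *m rank_block A (block_mx Sigma 0 0 0) *m V^t*
    & B = U *m rank_block A (block_mx 0 B2 0 B4) *m V^t*].

End Decomposition.

Arguments rank_block {C m n} A M.
Arguments rank_block_tr {C m n} A M.
Arguments star_decomp {C m n} A B U V Sigma B2 B4.

(* Main.v *)
Require Import Defs.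
From mathcomp Require Import all_boot all_order all_algebra.
From mathcomp Require Import spectral sesquilinear.
From mathcomp Require Import complex.
From mathcomp Require Import reals.
Local Open Scope ring_scope.
Local Open Scope sesquilinear_scope.

(** Take [V] (resp. [U]) unitary with its first [r] columns spanning the column
    space of [A^*] (resp. of [A]): then [U^* A V] is concentrated in its upper
    left block, and [B A^* = 0] says precisely that [B] kills the first [r] columns of [V].  The formula for the pseudoinverse
    comes from [C^+ = (C^* C)^+ C^*] with [C] the column [B_2 ; B_4], together
    with the behaviour of the pseudoinverse under zero padding and unitary
    equivalence. *)

Set Implicit Arguments.
Unset Strict Implicit.
Unset Printing Implicit Defensive.

Import Order.TTheory GRing.Theory Num.Theory.

Section ConjugateTranspose.
Context {C : numClosedFieldType}.

Lemma trmxC0 m n : (0 : 'M[C]_(m, n))^t* = 0.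
Proof. by rewrite trmx0 map_mx0. Qed.

Lemma trmxC_col m1 m2 n (M : 'M[C]_(m1, n)) (N : 'M[C]_(m2, n)) :
  (col_mx M N)^t* = row_mx (M^t*) (N^t*).
Proof. by rewrite tr_col_mx map_row_mx. Qed.

Lemma trmxC_block m1 m2 n1 n2 (Q : 'M[C]_(m1, n1)) (S : 'M[C]_(m1, n2))
    (T : 'M[C]_(m2, n1)) (W : 'M[C]_(m2, n2)) :
  (block_mx Q S T W)^t* = block_mx (Q^t*) (T^t*) (S^t*) (W^t*).
Proof. by rewrite tr_block_mx map_block_mx. Qed.

(** The diagonal entries of [M^t* *m M] are the squared norms of the rows of [M^t*], so these rows
    vanish by positivity of the Hermitian form. *)
Lemma gram_eq0 m n (M : 'M[C]_(m, n)) : M^t* *m M = 0 -> M = 0.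
Proof.
move=> MM0; suff M0 : M^t* = 0 by rewrite -[M]trmxCK M0 trmxC0.
apply/row_matrixP => i.
rewrite row0; apply/eqP; apply: contraTT isT => /(@dotmx_is_dotmx C m).
by rewrite dotmxE rowE mul_trmxC trmxCK mulmxA -(mulmxA _ _ M) MM0 mulmx0
  mul0mx mxE ltxx.
Qed.

End ConjugateTranspose.

Section MoorePenroseFormulas.
Context {C : numClosedFieldType}.

Lemma mpinvE m n (M : 'M[C]_(m, n)) X : is_mpinv M X -> mpinv M = X.
Proof. exact/is_mpinv_uniq/mpinvP. Qed.

Lemma is_mpinv_trmxC m n (M : 'M[C]_(m, n)) X :
  is_mpinv M X -> is_mpinv (M^t*) (X^t*).
Proof.
case/and4P=> /eqP X1 /eqP X2 /eqP X3 /eqP X4; apply/and4P.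
by split; rewrite -?mul_trmxC ?mulmxA ?X1 ?X2 -?mulmxA -?mul_trmxC ?trmxCK
  ?mulmxA ?X1 ?X2 ?X3 ?X4.
Qed.

(** The Penrose equations for [P *m M^t*] reduce to those of the Gram matrix [G], once [P] is known
    to be Hermitian and the left factor [M^t*] has been cancelled from [G *m P *m G = G]. *)
Lemma mpinv_gram m n (M : 'M[C]_(m, n)) :
  mpinv M = mpinv (M^t* *m M) *m M^t*.
Proof.
set G := M^t* *m M; set P := mpinv G.
have GP := mpinvP G; rewrite -/P in GP.
have GE : G^t* = G by rewrite /G mul_trmxC trmxCK.
(* Since [G] is Hermitian, [P^t*] is a pseudoinverse of [G] too; uniqueness applies. *)
have PE : P^t* = P.
  apply: (is_mpinv_uniq _ GP).
  by rewrite -[X in is_mpinv X]GE; apply: is_mpinv_trmxC.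
case/and4P: GP => /eqP G1 /eqP G2 /eqP G3 /eqP G4.
have MPG : M *m P *m G = M.
  (* The difference is [M *m (P *m G - 1%:M)], whose Gram matrix has the factor
     [G *m P *m G - G = 0]. *)
  apply/eqP; rewrite -subr_eq0; apply/eqP/gram_eq0.
  have -> : M *m P *m G - M = M *m (P *m G - 1%:M).
    by rewrite mulmxBr mulmx1 (mulmxA M P).
  rewrite mul_trmxC -mulmxA (mulmxA (M^t*)) -/G mulmxBr mulmx1 (mulmxA G P) G1.
  by rewrite subrr mulmx0.
apply/mpinvE/and4P; split; apply/eqP.
- by rewrite -!mulmxA -/G mulmxA MPG.
- by rewrite -(mulmxA P) -/G mulmxA G2.
- by rewrite !mul_trmxC trmxCK PE mulmxA.
- by rewrite -mulmxA -/G.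
Qed.

Lemma mpinv_row0mx m n1 n2 (M : 'M[C]_(m, n2)) :
  mpinv (row_mx (0 : 'M[C]_(m, n1)) M) = col_mx 0 (mpinv M).
Proof.
have /and4P[/eqP X1 /eqP X2 /eqP X3 /eqP X4] := mpinvP M.
apply/mpinvE/and4P.
rewrite mul_row_col mul_col_row !mul0mx !mulmx0 add0r; split; apply/eqP.
- by rewrite mul_mx_row mulmx0 X1.
- by rewrite mul_block_col !mul0mx !add0r X2.
- exact: X3.
- by rewrite trmxC_block !trmxC0 X4.
Qed.

Lemma mpinv_unitary_equiv m n (U : 'M[C]_m) (V : 'M[C]_n) (M : 'M[C]_(m, n)) :
  U \is unitarymx -> V \is unitarymx ->
  mpinv (U *m M *m V^t*) = V *m mpinv M *m U^t*.
Proof.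
move=> Uu Vu.
have UU : U^t* *m U = 1%:M by apply/mulmx1C/unitarymxP.
have VV : V^t* *m V = 1%:M by apply/mulmx1C/unitarymxP.
have /and4P[/eqP X1 /eqP X2 /eqP X3 /eqP X4] := mpinvP M.
have MX : U *m M *m V^t* *m (V *m mpinv M *m U^t*)
          = U *m (M *m mpinv M) *m U^t*.
  by rewrite !mulmxA -(mulmxA _ (V^t*)) VV mulmx1.
have XM : V *m mpinv M *m U^t* *m (U *m M *m V^t*)
          = V *m (mpinv M *m M) *m V^t*.
  by rewrite !mulmxA -(mulmxA _ (U^t*)) UU mulmx1.
apply/mpinvE/and4P; split; apply/eqP.
- rewrite MX !mulmxA -(mulmxA _ (U^t*)) UU mulmx1.
  by rewrite -2!(mulmxA U) X1.
- rewrite XM !mulmxA -(mulmxA _ (V^t*)) VV mulmx1.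
  by rewrite -2!(mulmxA V) X2.
- by rewrite MX !mul_trmxC trmxCK -mul_trmxC X3 !mulmxA.
- by rewrite XM !mul_trmxC trmxCK -mul_trmxC X4 !mulmxA.
Qed.

End MoorePenroseFormulas.

Section BlockDecomposition.
Context {C : numClosedFieldType}.

(** Gram-Schmidt is applied to a row basis of [M] and to one of its orthogonal complement. The free
    sizes [r] and [q] let the result fit matrices whose size is already a sum. *)
Lemma orthonormal_row_completion k n r q (M : 'M[C]_(k, n)) :
  \rank M = r -> (r + q)%N = n ->
  exists (X : 'M[C]_(r, n)) (Y : 'M[C]_(q, n)),
    col_mx X Y \is unitarymx /\ (X :=: M)%MS.
Proof.
move=> rM nE; have : (n - \rank M)%N = q by rewrite rM -nE addKn.
rewrite -rank_ortho => qE; case: r / rM nE => _; case: q / qE.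
eexists _, _; split; first exact: schmidt_complete_unitarymx.
apply: eqmx_trans (eq_row_base M).
exact/eqmx_schmidt_free/row_base_free.
Qed.

Section Square.
Variables (r p q : nat) (A B : 'M[C]_(r + p, r + q)).

Lemma block_decomp_exists : \rank A = r -> B *m A^t* = 0 ->
  exists (U : 'M[C]_(r + p)) (V : 'M[C]_(r + q)) (Sigma : 'M[C]_r)
         (B2 : 'M[C]_(r, q)) (B4 : 'M[C]_(p, q)),
    [/\ U \is unitarymx, V \is unitarymx, Sigma \in unitmx,
        A = U *m block_mx Sigma 0 0 0 *m V^t*
      & B = U *m block_mx 0 B2 0 B4 *m V^t*].
Proof.
move=> rA BA.
(* The library's subspaces are row spaces: the rows of [X] span that of [A], and their conjugate
   transposes will be the first [r] columns of [V]. Likewise [Z], built from [A^t*], yields those of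
   [U]. *)
have [X [Y [XYu XA]]] := orthonormal_row_completion rA (erefl (r + q)%N).
have rAC : \rank (A^t*) = r by rewrite mxrank_map mxrank_tr.
have [Z [W [ZWu ZA]]] := orthonormal_row_completion rAC (erefl (r + p)%N).
have [_ XY0 _ _] : [/\ X *m X^t* = 1%:M, X *m Y^t* = 0, Y *m X^t* = 0
                     & Y *m Y^t* = 1%:M].
  apply: eq_block_mx; rewrite -scalar_mx_block -mul_col_row -trmxC_col.
  exact/unitarymxP.
have [_ _ WZ0 _] : [/\ Z *m Z^t* = 1%:M, Z *m W^t* = 0, W *m Z^t* = 0
                     & W *m W^t* = 1%:M].
  apply: eq_block_mx; rewrite -scalar_mx_block -mul_col_row -trmxC_col.
  exact/unitarymxP.
have AY0 : A *m Y^t* = 0.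
  have /submxP[K ->] : (A <= X)%MS by rewrite XA.
  by rewrite -mulmxA XY0 mulmx0.
have WA0 : W *m A = 0.
  have /submxP[K AE] : (A^t* <= Z)%MS by rewrite ZA.
  by rewrite -[A]trmxCK AE mul_trmxC mulmxA WZ0 mul0mx.
(* The hypothesis enters here, through the inclusion opposite to the one used for [AY0]:
   [X = K *m A] gives [B *m X^t* = B *m A^t* *m K^t* = 0]. *)
have BX0 : B *m X^t* = 0.
  have /submxP[K ->] : (X <= A)%MS by rewrite XA.
  by rewrite mul_trmxC mulmxA BA mul0mx.
pose U := (col_mx Z W)^t*; pose V := (col_mx X Y)^t*.
have Uu : U \is unitarymx by rewrite trmxC_unitary.
have Vu : V \is unitarymx by rewrite trmxC_unitary.
have conj M : M = U *m (U^t* *m M *m V) *m V^t*.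
  by rewrite !mulmxA (unitarymxP Uu) mul1mx -mulmxA (unitarymxP Vu) mulmx1.
have blockE M : U^t* *m M *m V =
  block_mx (Z *m M *m X^t*) (Z *m M *m Y^t*)
           (W *m M *m X^t*) (W *m M *m Y^t*).
  by rewrite /U /V trmxCK trmxC_col mul_col_mx mul_col_row.
have AE : U^t* *m A *m V = block_mx (Z *m A *m X^t*) 0 0 0.
  by rewrite blockE -(mulmxA Z A (Y^t*)) AY0 WA0 mulmx0 !mul0mx.
exists U, V, (Z *m A *m X^t*), (Z *m B *m Y^t*), (W *m B *m Y^t*).
split=> //.
(* Unitary factors preserve rank and the zero blocks add none, so the upper left block has rank [r],
   its full size. *)
- rewrite -row_free_unit /row_free -[X in _ == X]rA.
  have : \rank (U^t* *m A *m V) = \rank A.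
    rewrite mxrankMfree ?row_free_unit ?unitarymx_unit //.
    by rewrite eqmxMfull // row_full_unit unitarymx_unit // trmxC_unitary.
  by rewrite AE rank_diag_block_mx mxrank0 addn0 => ->.
- by rewrite -AE -conj.
- rewrite {1}[B]conj blockE -(mulmxA Z B (X^t*)) -(mulmxA W B (X^t*)).
  by rewrite BX0 !mulmx0.
Qed.

Variables (U : 'M[C]_(r + p)) (V : 'M[C]_(r + q)) (Sigma : 'M[C]_r).
Variables (B2 : 'M[C]_(r, q)) (B4 : 'M[C]_(p, q)).

(** Once [V^t* *m V] cancels, the two block matrices meet with their nonzero blocks in disjoint sets
    of columns. *)
Lemma block_decomp_orthogonal : V \is unitarymx ->
  (U *m block_mx 0 B2 0 B4 *m V^t*) *m (U *m block_mx Sigma 0 0 0 *m V^t*)^t*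
  = 0.
Proof.
move=> Vu; have VV : V^t* *m V = 1%:M by apply/mulmx1C/unitarymxP.
rewrite !mul_trmxC trmxCK !mulmxA -(mulmxA _ (V^t*)) VV mulmx1.
rewrite -(mulmxA U) trmxC_block !trmxC0 mulmx_block.
by rewrite !mul0mx !mulmx0 !addr0 block_mx0 mulmx0 mul0mx.
Qed.

Lemma mpinv_block_decomp : U \is unitarymx -> V \is unitarymx ->
  mpinv (U *m block_mx 0 B2 0 B4 *m V^t*) =
  V *m block_mx 0 0
         (mpinv (B2^t* *m B2 + B4^t* *m B4) *m B2^t*)
         (mpinv (B2^t* *m B2 + B4^t* *m B4) *m B4^t*) *m U^t*.
Proof.
move=> Uu Vu; rewrite mpinv_unitary_equiv //; congr (_ *m _ *m _).
(* The block matrix is read as a zero block beside the column [col_mx B2 B4], whose Gram matrix is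
   [B2^t* *m B2 + B4^t* *m B4]. *)
rewrite block_mxEh col_mx0 mpinv_row0mx mpinv_gram trmxC_col mul_row_col.
by rewrite mul_mx_row -[0 in LHS]row_mx0 block_mxEv.
Qed.

End Square.
End BlockDecomposition.

(* Quantifying over the casts makes it possible to eliminate them, which the
   dependency of [rank_block A] on [\rank A] prevents in place. *)
Section CastDecomposition.
Context {C : numClosedFieldType} {m n r p q : nat}.
Variables (em : (r + p = m)%N) (en : (r + q = n)%N) (A B : 'M[C]_(m, n)).

Lemma cast_decomp_exists : \rank A = r -> B *m A^t* = 0 ->
  exists (U : 'M[C]_m) (V : 'M[C]_n) (Sigma : 'M[C]_r)
         (B2 : 'M[C]_(r, q)) (B4 : 'M[C]_(p, q)),
    [/\ U \is unitarymx, V \is unitarymx, Sigma \in unitmx,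
        A = U *m castmx (em, en) (block_mx Sigma 0 0 0) *m V^t*
      & B = U *m castmx (em, en) (block_mx 0 B2 0 B4) *m V^t*].
Proof.
by case: m / em A B; case: n / en => A' B'; apply: block_decomp_exists.
Qed.

Variables (U : 'M[C]_m) (V : 'M[C]_n) (Sigma : 'M[C]_r).
Variables (B2 : 'M[C]_(r, q)) (B4 : 'M[C]_(p, q)).

Lemma cast_decomp_orthogonal : V \is unitarymx ->
  (U *m castmx (em, en) (block_mx 0 B2 0 B4) *m V^t*)
    *m (U *m castmx (em, en) (block_mx Sigma 0 0 0) *m V^t*)^t* = 0.
Proof.
by case: m / em U; case: n / en V => V' U'; apply: block_decomp_orthogonal.
Qed.

Lemma mpinv_cast_decomp : U \is unitarymx -> V \is unitarymx ->
  mpinv (U *m castmx (em, en) (block_mx 0 B2 0 B4) *m V^t*) =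
  V *m castmx (en, em) (block_mx 0 0
         (mpinv (B2^t* *m B2 + B4^t* *m B4) *m B2^t*)
         (mpinv (B2^t* *m B2 + B4^t* *m B4) *m B4^t*)) *m U^t*.
Proof.
by case: m / em U; case: n / en V => V' U'; apply: mpinv_block_decomp.
Qed.

End CastDecomposition.

Theorem theorem2p6 (R : realType) (m n : nat) (A B : 'M[R[i]]_(m, n)) :
  (B *m A^t* = 0 <->
   exists (U : 'M[R[i]]_m) (V : 'M[R[i]]_n) (Sigma : 'M[R[i]]_(\rank A))
          (B2 : 'M[R[i]]_(\rank A, n - \rank A))
          (B4 : 'M[R[i]]_(m - \rank A, n - \rank A)),
     star_decomp A B U V Sigma B2 B4)
  /\
  (forall (U : 'M[R[i]]_m) (V : 'M[R[i]]_n) (Sigma : 'M[R[i]]_(\rank A))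
          (B2 : 'M[R[i]]_(\rank A, n - \rank A))
          (B4 : 'M[R[i]]_(m - \rank A, n - \rank A)),
     star_decomp A B U V Sigma B2 B4 ->
     mpinv B =
       V *m rank_block_tr A
              (block_mx 0 0
                 (mpinv (B2^t* *m B2 + B4^t* *m B4) *m B2^t*)
                 (mpinv (B2^t* *m B2 + B4^t* *m B4) *m B4^t*))
         *m U^t*).
Proof.
split; last first.
  by move=> U V Sigma B2 B4 [Uu Vu _ _ ->]; apply: mpinv_cast_decomp.
split=> [|[U [V [Sigma [B2 [B4 [_ Vu _ AE BE]]]]]]].
  exact: cast_decomp_exists.
(* [A] also fixes the block sizes through [\rank A], so it is replaced only in the product and not
   by a global rewrite. *)
apply: etrans (congr2 (fun M N => M *m N^t*) BE AE) _.
exact: cast_decomp_orthogonal.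
Qed.
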